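(* Assume impermeable boundary conditions $\int_{\partial\Omega}\mathbf v\cdot\mathbf n\,\mathrm ds=0$, i.e. at the discrete level $\mathbf v_p\cdot l_{pb}\mathbf n_{pb}=0$ at every boundary node $p$. Consider a solution $(\tau_c,\mathbf v_c,S_c)_c$, $(\mathbf x_p)_p$ of the semi-discrete scheme: for every cell $c$, $$m_c\frac{\mathrm d\tau_c}{\mathrm dt}-\sum_{p\in\mathcal P(c)}l_{pc}\mathbf n_{pc}\cdot(\mathbf v_p-\mathbf v_c)=0,$$ $$m_c\frac{\mathrm d\mathbf v_c}{\mathrm dt}+\sum_{p\in\mathcal P(c)}\Big[l_{pc}\mathbf n_{pc}\,(p_p-p_c)+\|l_{pc}\mathbf n_{pc}\|\,\alpha_p\,(\mathbf v_c-\mathbf v_p)\Big]=\mathbf 0,$$ $$m_c\frac{\mathrm dS_c}{\mathrm dt}=0,$$ and $\frac{\mathrm d\mathbf x_p}{\mathrm dt}=\mathbf v_p$ for every node $p$, where the nodal fluxes are $$\mathbf v_p=\frac{\sum_{c\in\mathcal C(p)}\|l_{pc}\mathbf n_{pc}\|\,\mathbf v_c}{\sum_{c\in\mathcal C(p)}\|l_{pc}\mathbf n_{pc}\|},\qquad p_p=\frac{\sum_{c\in\mathcal C(p)}\|l_{pc}\mathbf n_{pc}\|\,p_c}{\sum_{c\in\mathcal C(p)}\|l_{pc}\mathbf n_{pc}\|},$$ and the correction factor is $$\alpha_p=\frac{\sum_{c\in\mathcal C(p)}l_{pc}\mathbf n_{pc}\cdot(p_c\mathbf v_c-p_c\mathbf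 v_p-p_p\mathbf v_c)}{\sum_{c\in\mathcal C(p)}\|l_{pc}\mathbf n_{pc}\|\,|\mathbf v_c-\mathbf v_p|^2}$$ (with $\alpha_p=0$ if the denominator vanishes). Then the scheme is nonlinearly stable in the energy norm, in the sense that $$\int_\Omega\rho\,\frac{\mathrm dE}{\mathrm dt}\,\mathrm d\mathbf x=0,\qquad\text{that is,}\qquad \sum_c m_c\frac{\mathrm dE_c}{\mathrm dt}=0$$ at all times, where $E_c=\varepsilon(\tau_c,S_c)+\tfrac12|\mathbf v_c|^2$.
   Context: Mesh: a bounded moving domain $\Omega(t)\subset\mathbb R^2$ is covered by a conforming mesh of finitely many non-overlapping, non-degenerate triangles $\omega_c(t)$ (cells, indexed by $c$), with vertices (nodes) at positions $\mathbf x_p(t)$; the mesh topology is fixed in time. $\mathcal P(c)$ is the set of vertices of cell $c$, and $\mathcal C(p)$ the set of cells sharing node $p$. For $p\in\mathcal P(c)$, the two edges of $\omega_c$ meeting at $p$ have half-lengths $l_{pc}^-,l_{pc}^+$ (distances from $\mathbf x_p$ to the edge midpoints) and unit normals $\mathbf n_{pc}^-,\mathbf n_{pc}^+$ pointing outward from $\omega_c$; the corner vector is $l_{pc}\mathbf n_{pc}=l_{pc}^+\mathbf n_{pc}^++l_{pc}^-\mathbf n_{pc}^-$, and $\|l_{pc}\mathbf n_{pc}\|$ is its Euclidean norm. These satisfy $\sum_{p\in\mathcal P(c)}l_{pc}\mathbf n_{pc}=\mathbf 0$ for each cell, $\sum_{c\in\mathcal C(p)}l_{pc}\mathbf n_{pc}=\mathbf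 0$ for each interior node, and $\sum_{c\in\mathcal C(p)}l_{pc}\mathbf n_{pc}=l_{pb}\mathbf n_{pb}$ for each boundary node, where $l_{pb}\mathbf n_{pb}$ is the sum, over the two boundary edges meeting at $p$, of the half-length times the outward unit normal of $\Omega$. Unknowns: $\tau_c>0$ (specific volume), $\mathbf v_c\in\mathbb R^2$ (velocity), $S_c$ (specific entropy) are functions of time attached to each cell (mass averages); the density is $\rho_c=1/\tau_c$, and $m_c=|\omega_c(t)|/\tau_c(t)>0$ is the cell mass, constant in time. All geometric quantities depend on time through the $\mathbf x_p$. Equation of state: the specific internal energy $\varepsilon=\varepsilon(\tau,S)$ is a given smooth convex function; pressure and temperature are $p=-\partial\varepsilon/\partial\tau$ and $\theta=\partial\varepsilon/\partial S$, with $\theta>0$; $p_c=p(\tau_c,S_c)$ and $\theta_c=\theta(\tau_c,S_c)$. The specific total energy is $E=\varepsilon+\frac12|\mathbf v|^2$. *)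

(* Defs.v *)
From HB Require Import structures.
From mathcomp Require Import all_boot all_order all_algebra.
From mathcomp Require Import all_classical all_reals all_analysis.

Set Implicit Arguments.
Unset Strict Implicit.
Unset Printing Implicit Defensive.

Import Order.TTheory GRing.Theory Num.Theory.
Import numFieldNormedType.Exports.

Local Open Scope ring_scope.
Local Open Scope classical_set_scope.

(* Points and vectors of the Euclidean plane are pairs [R * R].  The library
   norm [`|u|] on a product is the sup norm, hence [enorm]. *)

Definition dot (R : realType) (u v : R * R) : R := u.1 * v.1 + u.2 * v.2.

Definition enorm (R : realType) (u : R * R) : R := Num.sqrt (dot u u).

Definition det2 (R : realType) (u v : R * R) : R := u.1 * v.2 - u.2 * v.1.

Definition area (R : realType) (A : set (R * R)) : R :=
  fine ((@lebesgue_measure R \x @lebesgue_measure R)%E A).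

Record topology (C P : finType) := Topology {
  nodes : C -> {set P};
  card_nodes : forall c, #|nodes c| = 3%N;
  nodes_cover : forall p, exists c, p \in nodes c }.

Definition cells (C P : finType) (T : topology C P) (p : P) : {set C} :=
  [set c | p \in nodes T c]%SET.

Section Geometry.
Context (R : realType) (C P : finType) (T : topology C P) (x : P -> R * R).

Definition hull (A : {set P}) : set (R * R) :=
  [set z | exists w : P -> R, [/\ forall p, p \in A -> 0 <= w p,
    \sum_(p in A) w p = 1 & z = \sum_(p in A) w p *: x p]].

(* The cell as an open triangle; its closure is [hull (nodes T c)]. *)
Definition cell (c : C) : set (R * R) :=
  [set z | exists w : P -> R, [/\ forall p, p \in nodes T c -> 0 < w p,
    \sum_(p in nodes T c) w p = 1 & z = \sum_(p in nodes T c) w p *: x p]].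

Definition domain : set (R * R) :=
  interior (\bigcup_(c in [set: C]) hull (nodes T c)).

Record is_mesh : Prop := IsMesh {
  mesh_nondegenerate : forall c p q r,
    p \in nodes T c -> q \in nodes T c -> r \in nodes T c ->
    p != q -> q != r -> p != r -> det2 (x q - x p) (x r - x p) != 0;
  mesh_nonoverlapping : forall c d, c != d -> cell c `&` cell d = set0;
  mesh_conforming : forall c d, c != d ->
    hull (nodes T c) `&` hull (nodes T d) = hull (nodes T c :&: nodes T d);
  mesh_connected : connected domain }.

Definition half_length (p q : P) : R :=
  enorm (2^-1 *: (x p + x q) - x p).

Definition barycenter (c : C) : R * R :=
  3^-1 *: \sum_(p in nodes T c) x p.

(* Unit normal to the edge [p q] of [c], oriented away from [c], i.e. away
   from the barycenter of [c]. *)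
Definition outward_normal (c : C) (p q : P) : R * R :=
  let e := x q - x p in
  let n := (enorm e)^-1 *: (e.2, - e.1) in
  if dot n (barycenter c - x p) < 0 then n else - n.

Definition corner (c : C) (p : P) : R * R :=
  \sum_(q in nodes T c | q != p) half_length p q *: outward_normal c p q.

Definition boundary_edge (p q : P) : bool :=
  (p != q) && (#|[set c | (p \in nodes T c) && (q \in nodes T c)]%SET| == 1%N).

Definition boundary_node (p : P) : bool := [exists q, boundary_edge p q].

(* On a boundary edge the outward normal of the domain is that of the only
   cell having this edge, so every boundary edge at [p] is counted once
   (there are two of them where the boundary is a curve). *)
Definition boundary_corner (p : P) : R * R :=
  \sum_(c in cells T p) \sum_(q in nodes T c | boundary_edge p q)
    half_length p q *: outward_normal c p q.

(* The piecewise constant field equal to [f c] in the cell [c]; it is zero on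
   the edges. *)
Definition cell_field (f : C -> R) (z : R * R) : R :=
  \sum_(c : C) f c * \1_(cell c) z.

Section Fluxes.
Context (v : C -> R * R) (pr : C -> R).

Definition weight (c : C) (p : P) : R := enorm (corner c p).

Definition node_velocity (p : P) : R * R :=
  (\sum_(c in cells T p) weight c p)^-1 *:
    \sum_(c in cells T p) weight c p *: v c.

Definition node_pressure (p : P) : R :=
  (\sum_(c in cells T p) weight c p * pr c) / (\sum_(c in cells T p) weight c p).

Definition correction (p : P) : R :=
  let num := \sum_(c in cells T p) dot (corner c p)
    (pr c *: v c - pr c *: node_velocity p - node_pressure p *: v c) in
  let den := \sum_(c in cells T p)
    weight c p * enorm (v c - node_velocity p) ^+ 2 in
  if den == 0 then 0 else num / den.

End Fluxes.

End Geometry.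

Section EquationOfState.
Context (R : realType).

(* With k + 1 derivatives: Frechet differentiable on [D], all directional
   derivatives being of class C^k on [D].  For [D] open this is C^infinity
   once required for every k. *)
Fixpoint Ck_on (k : nat) (D : set (R * R)) (f : R * R -> R) : Prop :=
  match k with
  | 0%N => forall z, D z -> {for z, continuous f}
  | k'.+1 => (forall z, D z -> differentiable f z) /\
             (forall u : R * R, Ck_on k' D (fun z => 'D_u f z))
  end.

Definition smooth_on (D : set (R * R)) (f : R * R -> R) : Prop :=
  forall k, Ck_on k D f.

Definition pressure (eps : R * R -> R) (tau S : R) : R :=
  - 'D_((1, 0) : R * R) eps (tau, S).

Definition temperature (eps : R * R -> R) (tau S : R) : R :=
  'D_((0, 1) : R * R) eps (tau, S).

Definition states : set (R * R) := [set z | 0 < z.1].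

Record equation_of_state (eps : R * R -> R) : Prop := EquationOfState {
  eos_smooth : smooth_on states eps;
  eos_convex : convex_function states eps;
  eos_temperature : forall tau S, 0 < tau -> 0 < temperature eps tau S }.

End EquationOfState.

(* Main.v *)
Require Import Defs.
From HB Require Import structures.
From mathcomp Require Import all_boot all_order all_algebra.
From mathcomp Require Import all_classical all_reals all_analysis.
From mathcomp Require Import measurable_realfun ring lra.

Set Implicit Arguments.
Unset Strict Implicit.
Unset Printing Implicit Defensive.

Import Order.TTheory GRing.Theory Num.Theory.
Import numFieldNormedType.Exports.

Local Open Scope ring_scope.
Local Open Scope classical_set_scope.

(** By the Gibbs relation, and since the entropy of each cell is constant, the
    energy of cell [c] varies at the rate
    [m c * E' = - pr c * (m c * tau') + v c . (m c * v')], and the scheme turns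
    the two products into sums over the nodes of [c]. Reordering the double
    sum node by node, the rate of the total energy becomes a sum over nodes of
    [N p - alpha p * K p], where [N p] is the power of the pressure fluxes
    around [p], which is the numerator of [alpha p], and
    [K p = \sum_c weight c p * (v c - vp p) . v c] is the work of the
    correction. Two identities make this sum vanish.

    - The contour of each cell is closed ([sum_corner_cell]), which allows one
      to put the power of the pressures in the form [N p]
      ([total_power_eq0]).
    - The nodal velocity is the weighted mean of the cell velocities, so [K p]
      is a weighted variance, namely the denominator of [alpha p]
      ([sum_weight_variance]).

    So [N p = alpha p * K p] as soon as [K p] is not zero. If [K p] is zero,
    then [alpha p] is zero and one has to check that [N p] vanishes too
    ([nodal_power_balance]): the cells with a nonzero corner at [p] all move
    with the velocity of [p], so [N p] is, up to the factor [- pp p], the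
    product of this velocity with the sum of the corner vectors at [p]. That
    sum is the boundary corner ([sum_corner_node]), because the two cells on
    an interior edge lie on opposite sides of it: two cells on the same side
    would overlap ([side_opposite]). Impermeability concludes.

    The integral over the domain is the sum over cells because a cell, being
    an intersection of three open half-planes, is both open, hence contained
    in the domain, and measurable, while the edges carry the value zero
    ([integral_cell_fieldM]); the density times the area is the mass. *)

(** * Euclidean plane *)

Section PlaneVectors.
Context (R : realType).
Implicit Types (u v w : R * R) (a : R).

Lemma dotC u v : dot u v = dot v u.
Proof. by rewrite /dot mulrC [u.2 * _]mulrC. Qed.

Lemma dotDr u v w : dot u (v + w) = dot u v + dot u w.
Proof. by rewrite /dot /=; ring. Qed.

Lemma dotBr u v w : dot u (v - w) = dot u v - dot u w.
Proof. by rewrite /dot /=; ring. Qed.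

Lemma dotZr a u v : dot u (a *: v) = a * dot u v.
Proof. by rewrite /dot /= /GRing.scale /=; ring. Qed.

Lemma dot0r u : dot u 0 = 0.
Proof. by rewrite /dot /= !mulr0 addr0. Qed.

Lemma dotZl a u v : dot (a *: v) u = a * dot v u.
Proof. by rewrite dotC dotZr (dotC u). Qed.

Lemma dot0l u : dot 0 u = 0.
Proof. by rewrite dotC dot0r. Qed.

Lemma dot_sumr (I : finType) (A : pred I) (F : I -> R * R) u :
  dot u (\sum_(i | A i) F i) = \sum_(i | A i) dot u (F i).
Proof. exact: (big_morph _ (dotDr u) (dot0r u)). Qed.

Lemma dot_suml (I : finType) (A : pred I) (F : I -> R * R) u :
  dot (\sum_(i | A i) F i) u = \sum_(i | A i) dot (F i) u.
Proof. by rewrite dotC dot_sumr; apply: eq_bigr => i _; exact: dotC. Qed.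

Lemma enorm_ge0 u : 0 <= enorm u.
Proof. exact: sqrtr_ge0. Qed.

Lemma enorm_sqr u : enorm u ^+ 2 = dot u u.
Proof. by rewrite sqr_sqrtr // /dot -!expr2 addr_ge0 ?sqr_ge0. Qed.

Lemma enorm_eq0 u : (enorm u == 0) = (u == 0).
Proof.
have -> : (enorm u == 0) = (enorm u ^+ 2 == 0) by rewrite expf_eq0.
rewrite enorm_sqr /dot -!expr2 paddr_eq0 ?sqr_ge0 // !expf_eq0 /=.
by case: u.
Qed.

Lemma enormZ a u : enorm (a *: u) = `|a| * enorm u.
Proof.
by rewrite /enorm dotZl dotZr mulrA -expr2 sqrtrM ?sqr_ge0 // sqrtr_sqr.
Qed.

End PlaneVectors.

(** * Corner vectors of a cell *)

Section MeshGeometry.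
Context (R : realType) (C P : finType) (T : topology C P) (x : P -> R * R).
Implicit Types (c d : C) (p q r : P).

Lemma third_node c p q : p \in nodes T c -> q \in nodes T c -> p != q ->
  exists r, [/\ r != p, r != q & nodes T c = [set p; q; r]%SET].
Proof.
move=> pc qc pq; have := card_nodes T c.
rewrite (cardsD1 p) pc (cardsD1 q) !inE eq_sym pq qc /= !add1n => -[].
move/eqP/cards1P => [r nE]; have : r \in [set r]%SET by rewrite inE.
rewrite -nE !inE => /and3P[rq rp rc]; exists r; split=> //.
apply/setP => k; rewrite !inE.
have := erefl (k \in [set r]%SET); rewrite -{1}nE !inE.
case: eqVneq => [->|_]; first by rewrite qc orbT.
by case: eqVneq => [->|_] /=; first by rewrite pc.
Qed.

Lemma nodes_triple c : exists p q r,
  [/\ p != q, r != p, r != q & nodes T c = [set p; q; r]%SET].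
Proof.
have [p pc] : exists p, p \in nodes T c by apply/card_gt0P; rewrite card_nodes.
have [q] : exists q, q \in (nodes T c :\ p)%SET.
  apply/card_gt0P.
  by have := card_nodes T c; rewrite (cardsD1 p) pc add1n => -[->].
rewrite !inE => /andP[qp qc]; rewrite eq_sym in qp.
by have [r [rp rq nE]] := third_node pc qc qp; exists p, q, r.
Qed.

Lemma big_triple (V : nmodType) (F : P -> V) p q r :
  p != q -> r != p -> r != q ->
  \sum_(k in [set p; q; r]%SET) F k = F p + F q + F r.
Proof.
move=> pq rp rq; rewrite finset.setUC big_setU1 /= ?inE ?negb_or ?rp //.
by rewrite big_setU1 ?inE // big_set1 addrC.
Qed.

Definition rot (u : R * R) : R * R := (u.2, - u.1).

(** Signed area (up to a constant) of the triangle spanned by the edge [p q]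
    and the barycenter: its sign tells on which side of the edge the cell is,
    without naming the third node. *)
Definition side c p q : R := det2 (x q - x p) (barycenter T x c - x p).

Lemma side_triple c p q r : p != q -> r != p -> r != q ->
  nodes T c = [set p; q; r]%SET ->
  side c p q = det2 (x q - x p) (x r - x p) / 3.
Proof.
move=> pq rp rq nE; rewrite /side /barycenter nE big_triple // /det2 /=.
by rewrite /GRing.scale /=; field.
Qed.

Lemma sideN c p q : side c q p = - side c p q.
Proof. by rewrite /side /det2 /=; ring. Qed.

(** The length of the edge cancels against the normalisation of the normal,
    so half an edge times its unit normal is, up to orientation, the rotated
    half-edge: a linear expression of the nodes. *)
Lemma half_edge_normal c p q : side c p q != 0 ->
  half_length x p q *: outward_normal T x c p q =
  (2^-1 * Num.sg (side c p q)) *: rot (x q - x p).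
Proof.
move=> s0; have e0 : x q - x p != 0.
  by apply: contra s0 => /eqP e0; rewrite /side e0 /det2 /= !mul0r subr0.
have en0 : 0 < enorm (x q - x p).
  by rewrite lt_def enorm_eq0 e0 enorm_ge0.
have -> : half_length x p q = 2^-1 * enorm (x q - x p).
  rewrite /half_length; have -> : 2^-1 *: (x p + x q) - x p =
      2^-1 *: (x q - x p).
    by apply: injective_projections; rewrite /= /GRing.scale /=; field.
  by rewrite enormZ ger0_norm // invr_ge0.
rewrite /outward_normal -/(rot (x q - x p)) dotZl.
have -> : dot (rot (x q - x p)) (barycenter T x c - x p) = - side c p q.
  by rewrite /dot /side /det2 /=; ring.
rewrite mulrN oppr_lt0 pmulr_rgt0 ?invr_gt0 //.
have cancel : (2^-1 * enorm (x q - x p)) * (enorm (x q - x p))^-1 = 2^-1.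
  by rewrite mulfK // gt_eqF.
case: ltrP => [sp|sn].
  by rewrite scalerA cancel gtr0_sg // mulr1.
rewrite ltr0_sg; last by rewrite lt_neqAle s0.
by rewrite scalerN scalerA cancel mulrN1 scaleNr.
Qed.

Hypothesis mesh : is_mesh T x.

Lemma side_neq0 c p q : p \in nodes T c -> q \in nodes T c -> p != q ->
  side c p q != 0.
Proof.
move=> pc qc pq; have [r [rp rq nE]] := third_node pc qc pq.
rewrite (side_triple pq rp rq nE) mulf_neq0 ?invr_eq0 //.
have rc : r \in nodes T c by rewrite nE !inE eqxx orbT.
by apply: (mesh_nondegenerate mesh pc qc rc) => //; rewrite eq_sym.
Qed.

(** The outward normals of a closed polygon, weighted by lengths, sum to zero:
    here each corner vector collects two half-edges, and the half-edges sum to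
    a rotated closed contour. *)
Lemma sum_corner_cell c : \sum_(p in nodes T c) corner T x c p = 0.
Proof.
have [p [q [r [pq rp rq nE]]]] := nodes_triple c.
have [pc qc rc] : [/\ p \in nodes T c, q \in nodes T c & r \in nodes T c].
  by rewrite nE !inE !eqxx !orbT.
have H a b : a \in nodes T c -> b \in nodes T c -> a != b ->
   half_length x a b *: outward_normal T x c a b =
   (2^-1 * Num.sg (side c a b)) *: rot (x b - x a).
  by move=> ac bc ab; rewrite half_edge_normal // side_neq0.
rewrite nE big_triple // /corner !big_mkcondr /= nE !big_triple //.
rewrite !eqxx [q == p]eq_sym [p == r]eq_sym [q == r]eq_sym pq rp rq /=.
rewrite !H // 1?eq_sym // !(sideN c p q) (sideN c r p) (sideN c q r).
have s1 := side_triple pq rp rq nE.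
have nE2 : nodes T c = [set q; r; p]%SET.
  by rewrite nE; apply/setP => k; rewrite !inE; do 3 case: (k == _).
have nE3 : nodes T c = [set r; p; q]%SET.
  by rewrite nE; apply/setP => k; rewrite !inE; do 3 case: (k == _).
rewrite (@side_triple c q r p) // 1?eq_sym //.
rewrite (@side_triple c r p q) // 1?eq_sym // s1.
have -> : det2 (x r - x q) (x p - x q) = det2 (x q - x p) (x r - x p).
  by rewrite /det2 /=; ring.
have -> : det2 (x p - x r) (x q - x r) = det2 (x q - x p) (x r - x p).
  by rewrite /det2 /=; ring.
rewrite sgrN.
by apply: injective_projections; rewrite /= /GRing.scale /=; ring.
Qed.

End MeshGeometry.

(** * Cells as intersections of half-planes *)

Section Cells.
Context (R : realType) (C P : finType) (T : topology C P) (x : P -> R * R).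
Implicit Types (c d : C) (p q r : P) (z : R * R).

Definition half_plane (a : R * R) (k : R) : set (R * R) :=
  [set z | 0 < dot a z + k].

Lemma open_half_plane a k : open (half_plane a k).
Proof.
apply: (@open_comp _ _ (fun z => dot a z + k) [set y | 0 < y]).
  move=> z _; apply: cvgD; last exact: cvg_cst.
  apply: cvgD; apply: cvgMr; [exact: cvg_fst|exact: cvg_snd].
exact: open_gt.
Qed.

Lemma measurable_half_plane a k : measurable (half_plane a k).
Proof.
have mf : measurable_fun [set: R * R] (fun z => dot a z + k).
  apply: measurable_funD => //; apply: measurable_funD.
    by apply: measurable_funM => //; exact: measurable_fst.
  by apply: measurable_funM => //; exact: measurable_snd.
have := mf measurableT `]0, +oo[%classic (measurable_itv _).
rewrite setTI; congr (measurable _); apply/seteqP.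
by split=> z /=; rewrite in_itv /= andbT.
Qed.

(** Barycentric coordinate of [z] at [p] in the triangle [p q r], as a ratio
    of signed areas. *)
Definition bary p q r z : R :=
  det2 (x q - z) (x r - z) / det2 (x q - x p) (x r - x p).

Lemma det2_cycle p q r :
  det2 (x r - x q) (x p - x q) = det2 (x q - x p) (x r - x p).
Proof. by rewrite /det2 /=; ring. Qed.

Lemma bary_convex (w : P -> R) p q r :
  det2 (x q - x p) (x r - x p) != 0 -> w p + w q + w r = 1 ->
  bary p q r (w p *: x p + w q *: x q + w r *: x r) = w p.
Proof.
move=> D0 w1; have -> : w r = 1 - w p - w q by rewrite -w1; ring.
rewrite /bary; apply: (canLR (mulfK D0)).
by rewrite /det2 /= /GRing.scale /=; ring.
Qed.

Lemma sum_bary p q r z : det2 (x q - x p) (x r - x p) != 0 ->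
  bary p q r z + bary q r p z + bary r p q z = 1.
Proof.
move=> D0; rewrite /bary (det2_cycle p q r) -(det2_cycle r p q).
rewrite -!mulrDl; apply: (canLR (mulfK D0)).
by rewrite /det2 /=; ring.
Qed.

Lemma sum_bary_nodes p q r z : det2 (x q - x p) (x r - x p) != 0 ->
  z = bary p q r z *: x p + bary q r p z *: x q + bary r p q z *: x r.
Proof.
move=> D0; rewrite /bary (det2_cycle p q r) -(det2_cycle r p q).
have avg (a b c y : R) : let D := det2 (x q - x p) (x r - x p) in
    y * D = det2 (x q - z) (x r - z) * a + det2 (x r - z) (x p - z) * b
            + det2 (x p - z) (x q - z) * c ->
    y = det2 (x q - z) (x r - z) / D * a + det2 (x r - z) (x p - z) / D * b
        + det2 (x p - z) (x q - z) / D * c.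
  by move=> D /(canRL (mulfK D0)) ->; rewrite !mulrDl -!mulrA !(mulrC D^-1).
by apply: injective_projections; apply: avg; rewrite /det2 /=; ring.
Qed.

(** The weights in the definition of a cell are determined by the point, so
    membership amounts to the positivity of three explicit functions. *)
Lemma cell_bary c p q r : p != q -> r != p -> r != q ->
  nodes T c = [set p; q; r]%SET -> det2 (x q - x p) (x r - x p) != 0 ->
  cell T x c = [set z | [/\ 0 < bary p q r z, 0 < bary q r p z &
                            0 < bary r p q z]].
Proof.
move=> pq rp rq nE D0.
have D1 : det2 (x r - x q) (x p - x q) != 0 by rewrite det2_cycle.
have D2 : det2 (x p - x r) (x q - x r) != 0 by rewrite -(det2_cycle r p q).
rewrite /cell nE; apply/seteqP; split=> z /=.
  move=> [w [w0]]; rewrite !big_triple // => w1 ->.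
  have w0' k : k \in [set p; q; r]%SET -> 0 < w k := w0 k.
  split.
  - by rewrite bary_convex // w0' // !inE eqxx.
  - rewrite -addrA addrC bary_convex ?w0' // ?inE ?eqxx ?orbT //.
    by rewrite addrC addrA.
  - rewrite addrC addrA bary_convex ?w0' // ?inE ?eqxx ?orbT //.
    by rewrite -addrA addrC.
move=> [bp bq br].
exists (fun k => if k == p then bary p q r z else if k == q then bary q r p z
                 else bary r p q z).
rewrite !big_triple // !eqxx [q == p]eq_sym (negbTE pq) (negbTE rp) (negbTE rq).
split; [|exact: sum_bary|exact: sum_bary_nodes].
by move=> k _; case: ifP => // _; case: ifP.
Qed.

(** Expanding the signed area as a function of [z] kills the quadratic term:
    barycentric coordinates are affine. *)
Lemma bary_half_plane p q r :
  exists a k, [set z | 0 < bary p q r z] = half_plane a k.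
Proof.
exists ((det2 (x q - x p) (x r - x p))^-1 *: rot (x q - x r)).
exists (det2 (x q) (x r) / det2 (x q - x p) (x r - x p)).
suff H z : bary p q r z = dot ((det2 (x q - x p) (x r - x p))^-1 *:
    rot (x q - x r)) z + det2 (x q) (x r) / det2 (x q - x p) (x r - x p).
  by apply/seteqP; split=> z /=; rewrite H.
rewrite dotZl mulrC -mulrDl /bary; congr (_ / _).
by rewrite /det2 /dot /=; ring.
Qed.

Hypothesis mesh : is_mesh T x.

Lemma cell_half_planes c : exists a1 k1 a2 k2 a3 k3, cell T x c =
  half_plane a1 k1 `&` half_plane a2 k2 `&` half_plane a3 k3.
Proof.
have [p [q [r [pq rp rq nE]]]] := nodes_triple T c.
have D0 : det2 (x q - x p) (x r - x p) != 0.
  by apply: (mesh_nondegenerate mesh (c := c));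
    rewrite ?nE ?inE ?eqxx ?orbT // eq_sym.
have [a1 [k1 E1]] := bary_half_plane p q r.
have [a2 [k2 E2]] := bary_half_plane q r p.
have [a3 [k3 E3]] := bary_half_plane r p q.
exists a1, k1, a2, k2, a3, k3; rewrite (cell_bary pq rp rq nE D0) -E1 -E2 -E3.
by apply/seteqP; split=> z /=; [case|case=> -[]].
Qed.

Lemma open_cell c : open (cell T x c).
Proof.
have [a1 [k1 [a2 [k2 [a3 [k3 ->]]]]]] := cell_half_planes c.
by do 2?apply: openI; exact: open_half_plane.
Qed.

Lemma measurable_cell c : measurable (cell T x c).
Proof.
have [a1 [k1 [a2 [k2 [a3 [k3 ->]]]]]] := cell_half_planes c.
by do 2?apply: measurableI; exact: measurable_half_plane.
Qed.

Lemma cell_domain c : cell T x c `<=` domain T x.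
Proof.
rewrite /domain -open_subsetE; last exact: open_cell.
move=> z [w [w0 w1 zE]]; exists c => //; exists w; split=> // p pc.
by rewrite ltW // w0.
Qed.

(** If both cells were on the same side of their common edge, moving from the
    midpoint of the edge slightly towards the third node of one of them would
    lead into both. *)
Lemma side_opposite c d p q : c != d -> p != q ->
  p \in nodes T c -> q \in nodes T c -> p \in nodes T d -> q \in nodes T d ->
  Num.sg (side T x d p q) = - Num.sg (side T x c p q).
Proof.
move=> cd pq pc qc pd qd.
have [r [rp rq cE]] := third_node pc qc pq.
have [s [sp sq dE]] := third_node pd qd pq.
have C0 := side_neq0 mesh pc qc pq; have D0 := side_neq0 mesh pd qd pq.
have := mesh_nonoverlapping mesh cd.
rewrite (side_triple x pq rp rq cE) (side_triple x pq sp sq dE) in C0 D0 *.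
move: C0 D0; rewrite !mulf_eq0 invr_eq0 !pnatr_eq0 !orbF => C0 D0.
rewrite (cell_bary pq rp rq cE C0) (cell_bary pq sp sq dE D0) => disj.
rewrite !sgrM !(gtr0_sg (_ : 0 < 3^-1)) ?invr_gt0 // !mulr1.
apply: contrapT => same.
have ratio : 0 < det2 (x q - x p) (x r - x p) / det2 (x q - x p) (x s - x p).
  move: same; case: (ltrgt0P (det2 _ (x r - x p))) C0 => // c0 _;
  case: (ltrgt0P (det2 _ (x s - x p))) D0 => // d0 _ same.
  - by rewrite divr_gt0.
  - by case: same; rewrite ltr0_sg // gtr0_sg.
  - by case: same; rewrite gtr0_sg // ltr0_sg // opprK.
  - by rewrite -mulrNN -invrN divr_gt0 ?oppr_gt0.
set A := bary p q s (x r); set B := bary q s p (x r).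
(* [e] is the step from the midpoint of the edge towards [x r]; it is taken
   small enough to outweigh the coordinates [A] and [B], which may be negative
   and arbitrarily large. *)
pose e := (2 + 2 * `|A| + 2 * `|B|)^-1.
have den : 0 < 2 + 2 * `|A| + 2 * `|B|.
  by rewrite -addrA ltr_wpDr // addr_ge0 // mulr_ge0.
have e0 : 0 < e by rewrite invr_gt0.
have eE : e * (2 + 2 * `|A| + 2 * `|B|) = 1 by rewrite mulVf // gt_eqF.
have eA : - (e * `|A|) <= e * A.
  by rewrite -mulrN ler_pM2l // lerNl -normrN ler_norm.
have eB : - (e * `|B|) <= e * B.
  by rewrite -mulrN ler_pM2l // lerNl -normrN ler_norm.
have eA0 : 0 <= e * `|A| by rewrite mulr_ge0 // ltW.
have eB0 : 0 <= e * `|B| by rewrite mulr_ge0 // ltW.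
have half : 2^-1 * (1 - e) = 2^-1 * e + e * `|A| + e * `|B| by lra.
have half0 : 0 < 2^-1 * (1 - e) by lra.
pose z := (2^-1 * (1 - e)) *: x p + (2^-1 * (1 - e)) *: x q + e *: x r.
have : ([set z | [/\ 0 < bary p q r z, 0 < bary q r p z
         & 0 < bary r p q z]] `&` [set z | [/\ 0 < bary p q s z,
         0 < bary q s p z & 0 < bary s p q z]]) z; last by rewrite disj.
have zr : det2 (x p - z) (x q - z) = e * det2 (x q - x p) (x r - x p).
  by rewrite /z /det2 /= /GRing.scale /=; field.
have D1 : det2 (x s - x q) (x p - x q) != 0 by rewrite det2_cycle.
have C1 : det2 (x r - x q) (x p - x q) != 0 by rewrite det2_cycle.
split; split.
- have -> : bary p q r z = 2^-1 * (1 - e).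
    rewrite /bary; apply: (canLR (mulfK C0)).
    by rewrite /z /det2 /= /GRing.scale /=; field.
  by [].
- have -> : bary q r p z = 2^-1 * (1 - e).
    rewrite /bary; apply: (canLR (mulfK C1)).
    by rewrite /z /det2 /= /GRing.scale /=; field.
  by [].
- have -> : bary r p q z = e; last by [].
  by rewrite /bary zr -(det2_cycle r p q) mulfK.
- have -> : bary p q s z = 2^-1 * (1 - e) + e * A.
    rewrite /A /bary; apply: (canLR (mulfK D0)).
    rewrite mulrDl -[e * _ * _]mulrA divfK //.
    by rewrite /z /det2 /= /GRing.scale /=; field.
  lra.
- have -> : bary q s p z = 2^-1 * (1 - e) + e * B.
    rewrite /B /bary; apply: (canLR (mulfK D1)).
    rewrite mulrDl -[e * _ * _]mulrA divfK //.
    by rewrite /z /det2 /= /GRing.scale /=; field.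
  lra.
- by rewrite /bary zr -(det2_cycle s p q) -mulrA mulr_gt0.
Qed.

End Cells.

(** * Balance around a node *)

Section NodalBalance.
Context (R : realType) (C P : finType) (T : topology C P) (x : P -> R * R).
Hypothesis mesh : is_mesh T x.

(** Off the boundary, two nodes either share no cell or span an edge of exactly
    two cells, on opposite sides: a third cell would have to be opposite to
    both. *)
Lemma sum_normals_interior_edge p q : p != q -> ~~ boundary_edge T p q ->
  \sum_(c | (c \in cells T p) && (q \in nodes T c))
    half_length x p q *: outward_normal T x c p q = 0.
Proof.
move=> pq; rewrite /boundary_edge pq /= => nb.
have [c cS|S0] := pickP [pred c | (p \in nodes T c) && (q \in nodes T c)];
  last by rewrite big_pred0 // => c; have := S0 c; rewrite /= inE.
have /andP[/= pc qc] := cS.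
have [d] : exists d, d \in ([set c | (p \in nodes T c) && (q \in nodes T c)]
    :\ c)%SET.
  apply/card_gt0P; move: nb; rewrite (cardsD1 c) inE pc qc add1n.
  by case: #|_|.
rewrite !inE => /and3P[dc pd qd].
have cd : c != d by rewrite eq_sym.
have opp := side_opposite mesh cd pq pc qc pd qd.
rewrite (bigD1 c) ?inE ?pc //= (bigD1 d) ?inE ?pd ?qd //= big1; last first.
  move=> e /andP[/andP[/andP[]]]; rewrite inE => pe qe ec ed.
  have ce : c != e by rewrite eq_sym.
  have de : d != e by rewrite eq_sym.
  have := side_opposite mesh ce pq pc qc pe qe.
  rewrite (side_opposite mesh de pq pd qd pe qe) opp opprK => /eqP.
  by rewrite -subr_eq0 opprK -mulr2n mulrn_eq0 sgr_eq0
    (negbTE (side_neq0 mesh pc qc pq)).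
rewrite !half_edge_normal ?(side_neq0 mesh) // opp mulrN scaleNr addr0.
exact: subrr.
Qed.

(** Summing the corner vectors around a node pairs up the two sides of every
    interior edge; only the boundary edges are left. *)
Lemma sum_corner_node p :
  \sum_(c in cells T p) corner T x c p = boundary_corner T x p.
Proof.
rewrite /corner (exchange_big_dep (fun q => q != p)) /=; last first.
  by move=> c q _ /andP[].
rewrite /boundary_corner (exchange_big_dep (boundary_edge T p)) /=; last first.
  by move=> c q _ /andP[].
rewrite (bigID (boundary_edge T p)) /= [X in _ + X]big1 ?addr0.
  apply: eq_big => [q|q /andP[qp bq]].
    by rewrite andb_idl // /boundary_edge eq_sym => /andP[].
  by apply: eq_bigl => c; rewrite qp bq.
move=> q /andP[qp nb]; rewrite eq_sym in qp.
rewrite -[RHS](sum_normals_interior_edge qp nb).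
by apply: eq_bigl => c; rewrite [q == p]eq_sym qp andbT.
Qed.

Lemma boundary_corner_interior p : ~~ boundary_node T p ->
  boundary_corner T x p = 0.
Proof.
move=> /existsPn nb; rewrite /boundary_corner big1 // => c _.
by rewrite big_pred0 // => q; rewrite (negbTE (nb q)) andbF.
Qed.

Context (v : C -> R * R) (pr : C -> R).
Let vp := node_velocity T x v.
Let pp := node_pressure T x pr.
Let alpha := correction T x v pr.

Lemma sum_weight_deviation p :
  \sum_(c in cells T p) weight T x c p *: (v c - vp p) = 0.
Proof.
under eq_bigr do rewrite scalerBr.
rewrite sumrB -scaler_suml /vp /node_velocity.
have [W0|W0] := eqVneq (\sum_(c in cells T p) weight T x c p) 0.
  rewrite W0 scale0r subr0 big1 // => c cp.
  rewrite (psumr_eq0P _ W0) ?scale0r // => d _; exact: enorm_ge0.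
by rewrite scalerA divff // scale1r subrr.
Qed.

(** The nodal velocity being the weighted mean of the cell velocities, the
    work of the correction is a weighted variance: the denominator of the
    correction factor. *)
Lemma sum_weight_variance p :
  \sum_(c in cells T p) weight T x c p * dot (v c - vp p) (v c) =
  \sum_(c in cells T p) weight T x c p * enorm (v c - vp p) ^+ 2.
Proof.
apply/eqP; rewrite -subr_eq0 -sumrB; apply/eqP.
rewrite -[RHS](dot0l (vp p)) -(sum_weight_deviation p) dot_suml.
by apply: eq_bigr => c _; rewrite enorm_sqr dotZl -mulrBr -dotBr subKr.
Qed.

(** When the denominator of the correction factor vanishes, all the cells
    around the node that have a nonzero corner move with the node, and the
    defect left to correct is the power of the nodal pressure against the sum
    of the corners, that is against the boundary: impermeability makes it
    vanish. *)
Lemma nodal_power_balance p :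
  dot (vp p) (boundary_corner T x p) = 0 ->
  \sum_(c in cells T p)
    (dot (corner T x c p) (pr c *: v c - pr c *: vp p - pp p *: v c)
     - weight T x c p * alpha p * dot (v c - vp p) (v c)) = 0.
Proof.
move=> wall; rewrite sumrB.
under [X in _ - X]eq_bigr do rewrite mulrAC mulrC.
rewrite -mulr_sumr sum_weight_variance /alpha /correction.
rewrite -/vp -/pp; case: eqVneq => [den0|den0]; last by rewrite divfK // subrr.
rewrite mul0r subr0.
transitivity (- pp p * dot (boundary_corner T x p) (vp p));
  last by rewrite dotC wall mulr0.
rewrite -sum_corner_node dot_suml mulr_sumr; apply: eq_bigr => c cp.
have /eqP : weight T x c p * enorm (v c - vp p) ^+ 2 = 0.
  apply: (psumr_eq0P _ den0) => // d _.
  by rewrite mulr_ge0 ?sqr_ge0 // enorm_ge0.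
rewrite mulf_eq0 expf_eq0 /= !enorm_eq0 => /orP[/eqP ->|].
- by rewrite !dot0l mulr0.
- by rewrite subr_eq0 => /eqP ->; rewrite subrr sub0r -scaleNr dotZr.
Qed.

Lemma sum_cells_nodes (F : C -> P -> R) :
  \sum_c \sum_(p in nodes T c) F c p = \sum_p \sum_(c in cells T p) F c p.
Proof.
rewrite (exchange_big_dep predT) //=; apply: eq_bigr => p _.
by apply: eq_bigl => c; rewrite inE.
Qed.

(** The scheme gives the term [pr c * (corner . v c)] twice, the numerator of
    the correction factor only once; the difference sums to zero on each cell,
    whose contour is closed. What remains is a sum of nodal balances. *)
Lemma total_power_eq0 :
  (forall p, dot (vp p) (boundary_corner T x p) = 0) ->
  \sum_c (pr c * (\sum_(p in nodes T c) dot (corner T x c p) (vp p - v c))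
   + dot (v c) (\sum_(p in nodes T c)
       ((pp p - pr c) *: corner T x c p
        + (weight T x c p * alpha p) *: (v c - vp p)))) = 0.
Proof.
move=> wall; apply/eqP; rewrite -oppr_eq0; apply/eqP; rewrite -sumrN.
transitivity (\sum_p \sum_(c in cells T p)
    (dot (corner T x c p) (pr c *: v c - pr c *: vp p - pp p *: v c)
     - weight T x c p * alpha p * dot (v c - vp p) (v c))); last first.
  by rewrite big1 // => p _; exact: nodal_power_balance.
rewrite -sum_cells_nodes; apply: eq_bigr => c _.
rewrite mulr_sumr dot_sumr -big_split /= -sumrN.
have : pr c * dot (\sum_(p in nodes T c) corner T x c p) (v c) = 0.
  by rewrite sum_corner_cell // dot0l mulr0.
rewrite dot_suml mulr_sumr => closed.
rewrite -[LHS]subr0 -[X in _ - X = _]closed.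
rewrite -sumrB.
apply: eq_bigr => p _.
move: (corner T x c p) (vp p) (v c) (weight T x c p) => l u w k.
by rewrite /dot /= /GRing.scale /=; ring.
Qed.

End NodalBalance.

(** * Integrals of piecewise constant fields *)

Section MeshIntegral.
Context (R : realType) (C P : finType) (T : topology C P) (x : P -> R * R).
Hypothesis mesh : is_mesh T x.
Let mu := (@lebesgue_measure R \x @lebesgue_measure R)%E.

Lemma cell_fieldM (f g : C -> R) z :
  cell_field T x f z * cell_field T x g z =
  \sum_c f c * g c * \1_(cell T x c) z.
Proof.
rewrite /cell_field mulr_suml; apply: eq_bigr => c _.
rewrite mulr_sumr (bigD1 c) //= big1 ?addr0 => [|d dc].
  by rewrite !indicE; case: (z \in _); rewrite /= ?mulr0 ?mulr1.
have disj := mesh_nonoverlapping mesh dc.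
rewrite !indicE; case: (boolP (z \in cell T x c)) => zc;
  last by rewrite mulr0 mul0r.
case: (boolP (z \in cell T x d)) => zd;
  last by rewrite !mulr0.
suff : (cell T x d `&` cell T x c) z by rewrite disj.
by split; exact/set_mem.
Qed.

(** A cell of infinite measure would have area zero, the real part of an
    infinite extended real being zero. *)
Lemma cell_measure c : area (cell T x c) != 0 ->
  mu (cell T x c) = (area (cell T x c))%:E.
Proof. by rewrite /area -/mu; case: (mu _) => //= ; rewrite eqxx. Qed.

(** The edges are ignored: the fields vanish outside the open cells, so the
    integral over the domain is the one over the plane, a finite sum of
    measures of cells. *)
Lemma integral_cell_fieldM (f g : C -> R) :
  (forall c, area (cell T x c) != 0) ->
  (\int[mu]_(z in domain T x) (cell_field T x f z * cell_field T x g z)%:E =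
   (\sum_c f c * g c * area (cell T x c))%:E)%E.
Proof.
move=> area0; rewrite integral_mkcond.
have ind c : mu.-integrable setT (fun z => (\1_(cell T x c) z)%:E).
  apply/integrableP; split.
    by apply/measurable_EFinP; apply: measurable_indic; exact: measurable_cell.
  under eq_integral => z _ do rewrite /= ger0_norm ?indicE ?ler0n // -indicE.
  rewrite integral_indic //; last exact: measurable_cell.
  by rewrite setIT [X in (X < _)%E](cell_measure (area0 c)) ltry.
transitivity (\int[mu]_z \sum_c ((f c * g c)%:E * (\1_(cell T x c) z)%:E))%E.
  apply: eq_integral => z _; rewrite /patch cell_fieldM.
  under [RHS]eq_bigr do rewrite -EFinM.
  rewrite sumEFin; case: ifPn => // zD; rewrite big1 // => c _.
  rewrite indicE memNset ?mulr0 // => /(cell_domain mesh) /mem_set.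
  by rewrite (negbTE zD).
rewrite integral_sum //; last by move=> c; exact: integrableZl.
rewrite -sumEFin; apply: eq_bigr => c _.
rewrite integralZl // integral_indic //; last exact: measurable_cell.
by rewrite setIT [X in (_ * X)%E](cell_measure (area0 c)) -EFinM.
Qed.

End MeshIntegral.

(** * Energy along a trajectory *)

Section EnergyDerivative.
Context (R : realType).

Lemma continuous_fst : continuous (@fst R R).
Proof. by move=> z; exact: cvg_fst. Qed.

Lemma continuous_snd : continuous (@snd R R).
Proof. by move=> z; exact: cvg_snd. Qed.

Lemma is_derive_fst (u : R -> R * R) t : derivable u t 1 ->
  is_derive t 1 (fun s => (u s).1) (derive1 u t).1.
Proof.
move=> /derivable1_diffP du.
have dfst : differentiable (@fst R R) (u t).
  by apply: linear_differentiable; exact: continuous_fst.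
have df := differentiable_comp du dfst.
apply: DeriveDef; first exact/derivable1_diffP.
rewrite deriveE // diff_comp //= diff_lin; last exact: continuous_fst.
by rewrite diff1E // scale1r.
Qed.

Lemma is_derive_snd (u : R -> R * R) t : derivable u t 1 ->
  is_derive t 1 (fun s => (u s).2) (derive1 u t).2.
Proof.
move=> /derivable1_diffP du.
have dsnd : differentiable (@snd R R) (u t).
  by apply: linear_differentiable; exact: continuous_snd.
have df := differentiable_comp du dsnd.
apply: DeriveDef; first exact/derivable1_diffP.
rewrite deriveE // diff_comp //= diff_lin; last exact: continuous_snd.
by rewrite diff1E // scale1r.
Qed.

Lemma is_derive_kinetic (u : R -> R * R) t : derivable u t 1 ->
  is_derive t 1 (fun s => 2^-1 * enorm (u s) ^+ 2) (dot (u t) (derive1 u t)).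
Proof.
move=> du; have d1 := is_derive_fst du; have d2 := is_derive_snd du.
have -> : (fun s => 2^-1 * enorm (u s) ^+ 2) = 2^-1 \*:
    ((fun s => (u s).1) * (fun s => (u s).1)
     + (fun s => (u s).2) * (fun s => (u s).2)).
  by apply/funext => s; rewrite enorm_sqr.
apply: is_derive_eq.
by rewrite /dot /GRing.scale /=; field.
Qed.

(** This is the Gibbs relation: temperature and pressure are, up to sign, the
    partial derivatives of [eps], and the chain rule combines them. *)
Lemma is_derive_internal (eps : R * R -> R) (tau s : R -> R) t :
  equation_of_state eps -> 0 < tau t ->
  derivable tau t 1 -> derivable s t 1 ->
  is_derive t 1 (fun r => eps (tau r, s r))
    (temperature eps (tau t) (s t) * derive1 s t
     - pressure eps (tau t) (s t) * derive1 tau t).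
Proof.
move=> eos tau0 /derivable1_diffP dtau /derivable1_diffP ds.
have [deps _] := eos_smooth eos 1.
have {}deps : differentiable eps (tau t, s t) by exact: deps.
have dpair := differentiable_pair dtau ds.
have dE := differentiable_comp dpair deps.
apply: DeriveDef; first exact/derivable1_diffP.
rewrite deriveE // diff_comp //= diff_pair // !diff1E // !scale1r.
have -> : (derive1 tau t, derive1 s t) =
    derive1 tau t *: ((1, 0) : R * R) + derive1 s t *: ((0, 1) : R * R).
  by apply: injective_projections; rewrite /= /GRing.scale /=; ring.
rewrite linearD !linearZ /= -!deriveE //.
by rewrite /temperature /pressure /GRing.scale /=; ring.
Qed.

End EnergyDerivative.

(** * Energy conservation *)

Unset Implicit Arguments.

Theorem theorem3p1 (R : realType) (C P : finType) (T : topology C P)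
    (eps : R * R -> R) (J : set R) (m : C -> R)
    (x : P -> R -> R * R) (tau : C -> R -> R) (v : C -> R -> R * R)
    (s : C -> R -> R) :
  let X t := fun p => x p t in
  let V t := fun c => v c t in
  let Pr t := fun c => pressure eps (tau c t) (s c t) in
  let vp t := node_velocity T (X t) (V t) in
  let pp t := node_pressure T (X t) (Pr t) in
  let alpha t := correction T (X t) (V t) (Pr t) in
  let lnc t := corner T (X t) in
  let rho t := fun c => (tau c t)^-1 in
  let E c := fun t => eps (tau c t, s c t) + 2^-1 * enorm (v c t) ^+ 2 in
  equation_of_state eps ->
  open J -> is_interval J ->
  (forall t, J t -> is_mesh T (X t)) ->
  (forall c t, J t -> 0 < tau c t) ->
  (forall c, 0 < m c) ->
  (forall c t, J t -> m c = area (cell T (X t) c) / tau c t) ->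
  (forall c t, J t -> derivable (tau c) t 1) ->
  (forall c t, J t -> derivable (v c) t 1) ->
  (forall c t, J t -> derivable (s c) t 1) ->
  (forall p t, J t -> derivable (x p) t 1) ->
  (forall c t, J t ->
    m c * derive1 (tau c) t
      - \sum_(p in nodes T c) dot (lnc t c p) (vp t p - v c t) = 0) ->
  (forall c t, J t ->
    m c *: derive1 (v c) t
      + \sum_(p in nodes T c)
          ((pp t p - Pr t c) *: lnc t c p
           + (enorm (lnc t c p) * alpha t p) *: (v c t - vp t p)) = 0) ->
  (forall c t, J t -> m c * derive1 (s c) t = 0) ->
  (forall p t, J t -> derive1 (x p) t = vp t p) ->
  (forall p t, J t -> boundary_node T p ->
    dot (vp t p) (boundary_corner T (X t) p) = 0) ->
  forall t, J t ->
    [/\ forall c, derivable (E c) t 1,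
        (\int[(@lebesgue_measure R \x @lebesgue_measure R)%E]_(z in
            domain T (X t))
          (cell_field T (X t) (rho t) z
           * cell_field T (X t) (fun c => derive1 (E c) t) z)%:E = 0)%E
      & \sum_(c : C) m c * derive1 (E c) t = 0].
Proof.
move=> X V Pr vp pp alpha lnc rho E eos _ _ mesh tau0 m0 mE dtau dv ds _.
move=> volume momentum entropy _ wall t Jt.
have dE c : is_derive t 1 (E c)
    (temperature eps (tau c t) (s c t) * derive1 (s c) t
     - Pr t c * derive1 (tau c) t + dot (v c t) (derive1 (v c) t)).
  have := is_derive_internal eos (tau0 c t Jt) (dtau c t Jt) (ds c t Jt).
  move=> dint; exact: is_deriveD dint (is_derive_kinetic (dv c t Jt)).
have no_wall p : dot (vp t p) (boundary_corner T (X t) p) = 0.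
  have [bp|ip] := boolP (boundary_node T p); first exact: wall.
  by rewrite boundary_corner_interior // dot0r.
have power0 : \sum_(c : C) m c * derive1 (E c) t = 0.
  apply: oppr_inj; rewrite oppr0 -sumrN.
  rewrite -[RHS](total_power_eq0 (mesh t Jt) (Pr t) no_wall).
  apply: eq_bigr => c _; rewrite derive1E derive_val.
  have /eqP := volume c t Jt; rewrite subr_eq0 => /eqP <-.
  have /eqP := momentum c t Jt; rewrite addrC addr_eq0 => /eqP.
  rewrite /weight => ->.
  have /eqP := entropy c t Jt; rewrite mulf_eq0 (gt_eqF (m0 c)) /= => /eqP ->.
  by rewrite /V /dot /= /GRing.scale /=; ring.
have area0 c : area (cell T (X t) c) != 0.
  apply/eqP => A0; have := mE c t Jt; rewrite A0 mul0r => m0'.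
  by have := m0 c; rewrite m0' ltxx.
split=> //.
rewrite (integral_cell_fieldM (mesh t Jt)) //; congr (_%:E).
rewrite -[RHS]power0.
by apply: eq_bigr => c _; rewrite (mE c t Jt) /rho; ring.
Qed.
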